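(* Let $\mathfrak F=\langle W,R\rangle$ be a fuzzy frame, $x\in W$, and $h,i,j,k\ge0$ natural numbers. Then $\lozenge^h\Box^ip\to\Box^j\lozenge^kp$ is $\mathbf{K}\mathsf{biG}$-valid on $\langle\mathfrak F,x\rangle$ if and only if for all $y,z\in W$, $$xR^hy\wedge_G xR^jz\ \le\ \sup_{w\in W}\{yR^iw\wedge_G zR^kw\}.$$
   Context: Gödel operations on $[0,1]$: $a\wedge_G b=\min(a,b)$, $a\vee_G b=\max(a,b)$, $a\to_G b=1$ if $a\le b$ and $=b$ otherwise. A fuzzy frame is $\langle W,R\rangle$, $W\ne\emptyset$, $R:W\times W\to[0,1]$. A model adds $e:\mathtt{Prop}\times W\to[0,1]$, extended with $\to$ evaluated by $\to_G$, $e(\Box\phi,w)=\inf_{w'}(wRw'\to_G e(\phi,w'))$, $e(\lozenge\phi,w)=\sup_{w'}(wRw'\wedge_G e(\phi,w'))$. A formula is $\mathbf{K}\mathsf{biG}$-valid on $\langle\mathfrak F,x\rangle$ iff $e(\phi,x)=1$ for every model on $\mathfrak F$. $\Box^n$, $\lozenge^n$ denote $n$ consecutive $\Box$'s, $\lozenge$'s. Fuzzy relation powers: $uR^0u'=1$ if $u=u'$ and $0$ otherwise; $uR^nu'=\sup_{w\in W}\{uRw\wedge_G wR^{n-1}u'\}$ for $n\ge1$. *)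

(* Defs.v *)
From mathcomp Require Import all_boot all_order all_algebra.
From mathcomp Require Import boolp classical_sets reals.

Set Implicit Arguments.
Unset Strict Implicit.
Unset Printing Implicit Defensive.

Import Order.TTheory GRing.Theory Num.Theory.
Local Open Scope classical_set_scope.
Local Open Scope ring_scope.

(* The truth-value algebra is [0,1]; it is represented inside R, and frames and
   valuations carry proofs that their values lie in [0,1].  As frames are
   nonempty, every sup and inf below is that of a nonempty subset of [0,1]. *)

Section GodelOperations.
Variable R : realType.
Implicit Types a b : R.

Definition gand a b : R := Num.min a b.
Definition gor a b : R := Num.max a b.
Definition gimp a b : R := if a <= b then 1 else b.
Definition gneg a : R := gimp a 0.
Definition gdelta a : R := if a == 1 then 1 else 0.

End GodelOperations.

Inductive formula : Type :=
  | Var of nat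
  | Neg of formula
  | Delta of formula
  | And of formula & formula
  | Or of formula & formula
  | Imp of formula & formula
  | Box of formula
  | Dia of formula.

Definition BoxN (n : nat) (phi : formula) : formula := iter n Box phi.
Definition DiaN (n : nat) (phi : formula) : formula := iter n Dia phi.

Record fuzzy_frame (R : realType) := FuzzyFrame {
  world : Type;
  frel : world -> world -> R;
  world_inhabited : inhabited world;
  frel01 : forall u v : world, 0 <= frel u v <= 1
}.

Record valuation (R : realType) (F : fuzzy_frame R) := Valuation {
  val_at :> nat -> world F -> R;
  val_at01 : forall (q : nat) (w : world F), 0 <= val_at q w <= 1
}.

Section Semantics.
Variables (R : realType) (F : fuzzy_frame R).
Implicit Types (e : valuation F) (w : world F).

Fixpoint eval e (phi : formula) w : R :=
  match phi with
  | Var q => e q w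
  | Neg psi => gneg (eval e psi w)
  | Delta psi => gdelta (eval e psi w)
  | And psi chi => gand (eval e psi w) (eval e chi w)
  | Or psi chi => gor (eval e psi w) (eval e chi w)
  | Imp psi chi => gimp (eval e psi w) (eval e chi w)
  | Box psi => inf (range (fun w' => gimp (frel w w') (eval e psi w')))
  | Dia psi => sup (range (fun w' => gand (frel w w') (eval e psi w')))
  end.

Definition KbiG_valid (x : world F) (phi : formula) : Prop :=
  forall e, eval e phi x = 1.

Fixpoint frel_pow (n : nat) (u u' : world F) : R :=
  match n with
  | 0 => if `[< u = u' >] then 1 else 0
  | m.+1 => sup (range (fun w => gand (frel u w) (frel_pow m w u')))
  end.

End Semantics.

(* Main.v *)
(** By residuation, [DiaN n phi] and [BoxN n phi] are a supremum and an infimum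
    over the relation power [frel_pow n], so validity amounts to
    R^h(x,y) /\ e(Box^i p, y) /\ R^j(x,z) <= e(Dia^k p, z) for all y, z and e.
    The frame condition yields this because R^i(y,w) /\ e(Box^i p, y) <= e(p,w).
    Conversely, e(p,w) := R^i(y,w) is the least valuation with
    e(Box^i p, y) = 1, and for it the inequality is the frame condition. *)

Require Import Defs.
From mathcomp Require Import all_boot all_order all_algebra.
From mathcomp Require Import boolp classical_sets reals.

Set Implicit Arguments.
Unset Strict Implicit.
Unset Printing Implicit Defensive.

Import Order.TTheory GRing.Theory Num.Theory.
Local Open Scope classical_set_scope.
Local Open Scope ring_scope.

Section GodelAlgebra.
Variable R : realType.
Implicit Types a b c : R.

(** Residuation. If [b <= c], the left side holds outright and the right side reads [a <= 1], hence
    the bound on [a]. *)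
Lemma gand_le_gimp a b c : a <= 1 -> (gand a b <= c) = (a <= gimp b c).
Proof.
move=> a1; rewrite /gand /gimp ge_min.
by case: (leP b c) => bc; rewrite ?orbT ?orbF ?a1.
Qed.

Lemma gandC a b : gand a b = gand b a.
Proof. exact: minC. Qed.

Lemma gandA a b c : gand a (gand b c) = gand (gand a b) c.
Proof. exact: minA. Qed.

Lemma gand_le2r c a b : a <= b -> gand a c <= gand b c.
Proof. by move=> ab; rewrite /gand le_min !ge_min ab lexx orbT. Qed.

Lemma gand01 a b : 0 <= a <= 1 -> 0 <= b <= 1 -> 0 <= gand a b <= 1.
Proof.
by move=> /andP[a0 a1] /andP[b0 b1]; rewrite /gand le_min ge_min a0 b0 a1.
Qed.

Lemma gimp01 a b : 0 <= b <= 1 -> 0 <= gimp a b <= 1.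
Proof. by rewrite /gimp; case: ifP => // _ _; rewrite ler01 lexx. Qed.

Lemma gimp_eq1 a b : a <= 1 -> gimp a b = 1 <-> a <= b.
Proof.
by rewrite /gimp => a1; case: ifP => // ab; split=> // b1; rewrite -ab b1.
Qed.

(** The inhabitant and the bound by 1 make [range f] nonempty and bounded above, so that the total
    function [sup] is a genuine least upper bound. *)
Lemma sup_range_le (T : Type) (f : T -> R) c : inhabited T ->
  (forall t, f t <= 1) -> sup (range f) <= c <-> forall t, f t <= c.
Proof.
move=> [t0] f1; split=> [supc t|fc].
  apply: le_trans supc; apply: ub_le_sup; last by exists t.
  by exists 1 => _ [u _ <-].
by apply: ge_sup => [|_ [t _ <-]//]; exists (f t0), t0.
Qed.

Lemma le_inf_range (T : Type) (f : T -> R) c : inhabited T ->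
  (forall t, 0 <= f t) -> c <= inf (range f) <-> forall t, c <= f t.
Proof.
move=> [t0] f0; split=> [cinf t|cf].
  apply: le_trans cinf _; apply: ge_inf; last by exists t.
  by exists 0 => _ [u _ <-].
by apply: lb_le_inf => [|_ [t _ <-]//]; exists (f t0), t0.
Qed.

Lemma sup_range01 (T : Type) (f : T -> R) : inhabited T ->
  (forall t, 0 <= f t <= 1) -> 0 <= sup (range f) <= 1.
Proof.
move=> T0 f01; have f1 t : f t <= 1 by have /andP[] := f01 t.
have supf := sup_range_le _ T0 f1.
case: (T0) => t; have /andP[ft0 _] := f01 t.
by rewrite (le_trans ft0) ?(iffLR (supf _)) //; apply/supf.
Qed.

Lemma inf_range01 (T : Type) (f : T -> R) : inhabited T ->
  (forall t, 0 <= f t <= 1) -> 0 <= inf (range f) <= 1.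
Proof.
move=> T0 f01; have f0 t : 0 <= f t by have /andP[] := f01 t.
have inff := le_inf_range _ T0 f0.
case: (T0) => t; have /andP[_ ft1] := f01 t.
by rewrite (le_trans _ ft1) ?(iffLR (inff _)) ?andbT //; apply/inff.
Qed.

(** Meet distributes over suprema because it has a residual: [b] moves to the right as [gimp b c],
    the supremum is split, and [b] moves back. *)
Lemma gand_sup_le (T : Type) (f : T -> R) b c : inhabited T ->
  (forall t, 0 <= f t <= 1) ->
  gand (sup (range f)) b <= c <-> forall t, gand (f t) b <= c.
Proof.
move=> T0 f01; have f1 t : f t <= 1 by have /andP[] := f01 t.
have /andP[_ sup1] := sup_range01 T0 f01.
rewrite gand_le_gimp //; split=> [/sup_range_le supf t|fc].
  by rewrite gand_le_gimp // supf.
by apply/sup_range_le => // t; rewrite -gand_le_gimp.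
Qed.

End GodelAlgebra.

Section Semantics.
Variables (R : realType) (F : fuzzy_frame R).
Implicit Types (e : valuation F) (u v w : world F).

Lemma frel_pow01 n u v : 0 <= frel_pow n u v <= 1.
Proof.
elim: n u => [|n IHn] u /=; first by case: ifP; rewrite ?ler01 lexx.
by apply: (sup_range01 (world_inhabited F)) => w; rewrite gand01 ?frel01.
Qed.

Lemma eval01 e phi w : 0 <= eval e phi w <= 1.
Proof.
elim: phi w => [q|psi IH|psi IH|psi IH chi IH'|psi IH chi IH'|psi IH chi IH'
  |psi IH|psi IH] w /=.
- exact: val_at01.
- by rewrite /gneg gimp01 // lexx ler01.
- by rewrite /gdelta; case: ifP; rewrite ?ler01 lexx.
- exact: gand01.
- by rewrite /gor maxEle; case: ifP.
- exact: gimp01.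
- by apply: (inf_range01 (world_inhabited F)) => u; apply: gimp01.
- by apply: (sup_range01 (world_inhabited F)) => u; rewrite gand01 ?frel01.
Qed.

(** The bound [c] varies in the induction: residuation absorbs the weight of the first step, and the
    induction hypothesis is used at [gimp (frel u w) c]. *)
Lemma eval_DiaN_le e phi n u (c : R) :
  eval e (DiaN n phi) u <= c <->
  forall v, gand (frel_pow n u v) (eval e phi v) <= c.
Proof.
have W0 := world_inhabited F.
elim: n u c => [|n IHn] u c /=.
  (* [frel_pow 0] is 1 at [v = u] and 0 elsewhere; the instances with [v <> u] hold since the value
     at [u] is nonnegative. *)
  split=> [uc v|/(_ u)]; last first.
    by rewrite asboolT // /gand min_r //; have /andP[] := eval01 e phi u.
  apply: le_trans uc; case: asboolP => [<-|_]; first by rewrite ge_min lexx orbT.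
  by rewrite ge_min; have /andP[->] := eval01 e phi u.
have body01 w : 0 <= gand (Defs.frel u w) (eval e (DiaN n phi) w) <= 1.
  by rewrite gand01 ?frel01 ?eval01.
have pow01 v w : 0 <= gand (Defs.frel u w) (frel_pow n w v) <= 1.
  by rewrite gand01 ?frel01 ?frel_pow01.
have step w : gand (Defs.frel u w) (eval e (DiaN n phi) w) <= c <->
    forall v, gand (gand (Defs.frel u w) (frel_pow n w v)) (eval e phi v) <= c.
  rewrite gandC gand_le_gimp; last by have /andP[] := eval01 e (DiaN n phi) w.
  have pe1 v : gand (frel_pow n w v) (eval e phi v) <= 1.
    by have /andP[] := gand01 (frel_pow01 n w v) (eval01 e phi v).
  rewrite IHn; split=> wc v; have := wc v.
    by rewrite -gand_le_gimp // gandC gandA.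
  by rewrite -gandA gandC gand_le_gimp.
(* Both sides amount to one inequality for all pairs of a first step [w] and an endpoint [v]; only
   the order of the quantifiers changes. *)
split=> [uc v|uc].
  apply/gand_sup_le => // w; move: v; apply/step; move: w.
  by apply/(sup_range_le _ W0) => // w; have /andP[] := body01 w.
apply/(sup_range_le _ W0) => [w|w]; first by have /andP[] := body01 w.
by apply/step => v; move: w; apply/gand_sup_le.
Qed.

(** Dual to [eval_DiaN_le]: residuation now moves the weight of the first step to the left, so the
    induction hypothesis is used at [gand d (frel u w)], which is still at most 1. *)
Lemma le_eval_BoxN e phi n u (d : R) : d <= 1 ->
  d <= eval e (BoxN n phi) u <->
  forall v, gand d (frel_pow n u v) <= eval e phi v.
Proof.
have W0 := world_inhabited F.
elim: n u d => [|n IHn] u d d1 /=.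
  split=> [du v|/(_ u)]; last by rewrite asboolT // /gand min_l.
  rewrite ge_min; case: asboolP => [<-|_]; first by rewrite du.
  by have /andP[-> _] := eval01 e phi v; rewrite orbT.
have gimp0 w : 0 <= gimp (Defs.frel u w) (eval e (BoxN n phi) w).
  by have /andP[] := gimp01 (Defs.frel u w) (eval01 e (BoxN n phi) w).
have pow01 v w : 0 <= gand (Defs.frel u w) (frel_pow n w v) <= 1.
  by rewrite gand01 ?frel01 ?frel_pow01.
have step w : d <= gimp (Defs.frel u w) (eval e (BoxN n phi) w) <->
    forall v, gand (gand (Defs.frel u w) (frel_pow n w v)) d <= eval e phi v.
  rewrite -gand_le_gimp // IHn; last by rewrite ge_min d1.
  by split=> dv v; have := dv v; rewrite [gand _ d]gandC gandA.
split=> [du v|du].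
  rewrite gandC; apply/gand_sup_le => // w; move: v; apply/step; move: w.
  exact/(le_inf_range _ W0).
apply/(le_inf_range _ W0) => // w; apply/step => v; move: w.
by apply/gand_sup_le => //; rewrite gandC.
Qed.

End Semantics.

Theorem theorem5p6 (R : realType) (F : fuzzy_frame R) (x : world F)
    (h i j k p : nat) :
  KbiG_valid x (Imp (DiaN h (BoxN i (Var p))) (BoxN j (DiaN k (Var p)))) <->
  forall y z : world F,
    gand (frel_pow h x y) (frel_pow j x z) <=
    sup (range (fun w : world F => gand (frel_pow i y w) (frel_pow k z w))).
Proof.
have W0 := world_inhabited F.
have eval1 e phi (w : world F) : eval e phi w <= 1.
  by have /andP[] := eval01 e phi w.
have pow1 n (u v : world F) : frel_pow n u v <= 1.
  by have /andP[] := frel_pow01 n u v.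
have pow201 (y z w : world F) : 0 <= gand (frel_pow i y w) (frel_pow k z w) <= 1.
  by rewrite gand01 ?frel_pow01.
(* Only the outer modalities are opened, the diamonds over [y] and then the boxes over [z]; the
   inner ones stay closed because the two directions treat them differently. *)
have validE e : eval e (Imp (DiaN h (BoxN i (Var p))) (BoxN j (DiaN k (Var p)))) x
      = 1 <->
    forall y z, gand (gand (frel_pow h x y) (frel_pow j x z))
      (eval e (BoxN i (Var p)) y) <= eval e (DiaN k (Var p)) z.
  have swap y z : gand (gand (frel_pow h x y) (eval e (BoxN i (Var p)) y))
      (frel_pow j x z) =
      gand (gand (frel_pow h x y) (frel_pow j x z)) (eval e (BoxN i (Var p)) y).
    by rewrite -!gandA [gand (eval _ _ _) _]gandC.
  have he1 y : gand (frel_pow h x y) (eval e (BoxN i (Var p)) y) <= 1.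
    by rewrite ge_min pow1.
  rewrite /= gimp_eq1 // eval_DiaN_le; split=> [val y z|val y].
    by have /le_eval_BoxN := val y => /(_ (he1 y) z); rewrite swap.
  by apply/le_eval_BoxN => // z; rewrite swap.
split=> [valid y z|cond e].
  pose e := @Valuation R F (fun _ w => frel_pow i y w)
    (fun _ w => frel_pow01 i y w).
  have boxy : 1 <= eval e (BoxN i (Var p)) y.
    by apply/le_eval_BoxN => // v; rewrite /= ge_min lexx orbT.
  have /validE/(_ y z) := valid e.
  (* The box has value at least 1 at [y], so its factor drops out of the meet. *)
  rewrite {1}/gand min_l; last by apply: le_trans boxy; rewrite ge_min pow1.
  (* Under this valuation the terms bounding the diamonds at [z] are, up to commutation, those of
     the target supremum. *)
  move=> /le_trans; apply; apply/eval_DiaN_le => w; rewrite gandC /=.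
  move: w; apply/(sup_range_le _ W0) => // w.
  by have /andP[] := pow201 y z w.
apply/validE => y z.
set b := eval e _ y.
apply: (@le_trans _ _ (gand
  (sup (range (fun w => gand (frel_pow i y w) (frel_pow k z w)))) b)).
  exact/gand_le2r/cond.
apply/gand_sup_le => // w.
(* Here and for [kw], the characterisation of the modality is applied with its own truth value as
   the bound, where it holds by reflexivity. *)
have bw : gand b (frel_pow i y w) <= e p w.
  by have /le_eval_BoxN := lexx b; apply; apply: eval1.
have kw : gand (frel_pow k z w) (e p w) <= eval e (DiaN k (Var p)) z.
  by move: w {bw}; apply/(eval_DiaN_le e (Var p)).
apply: le_trans kw; rewrite [gand (frel_pow k z w) (e p w)]gandC.
rewrite gandC gandA; exact: gand_le2r.
Qed.
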